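(* For every $n\geq 2$, the star graph $K_{1,n}$ satisfies $F_d(K_{1,n})=n$.
   Context: The star $K_{1,n}$ has one vertex of degree $n$ adjacent to $n$ vertices of degree $1$. Zero forcing: given a set $B\subseteq V(G)$ of initially black vertices (all others white) of a finite simple graph $G$, at each step a black vertex having exactly one white neighbor forces that neighbor to become black; $B$ is a zero forcing set of $G$ if repeated application of this rule turns all vertices black. A set $D\subseteq V(G)$ is dominating if every vertex of $G$ is in $D$ or adjacent to a vertex of $D$. A dom-forcing set of $G$ is a set $D_f\subseteq V(G)$ that is both a dominating set of $G$ and a zero forcing set of $G$; the dom-forcing number $F_d(G)$ is the minimum cardinality of a dom-forcing set. *)

(* Defs.v *)
From mathcomp Require Import all_boot.

Set Implicit Arguments.
Unset Strict Implicit.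
Unset Printing Implicit Defensive.

Record sgraph := SGraph {
  vertex :> finType;
  adj : rel vertex;
  adj_sym : symmetric adj;
  adj_irrefl : irreflexive adj }.

Definition white_nbrs (G : sgraph) (B : {set G}) (u : G) : {set G} :=
  [set w | adj u w & w \notin B].

(* A single force: some u in B has v as its only white neighbor, and v turns
   black. *)
Definition force_step (G : sgraph) : rel {set G} := fun B B' =>
  [exists u in B, exists v, (white_nbrs B u == [set v]) && (B' == v |: B)].

(* connect is the reflexive-transitive closure, here on the finite type of
   colourings, a colouring being identified with its set of black vertices. *)
Definition zero_forcing (G : sgraph) (B : {set G}) : bool :=
  connect (@force_step G) B [set: G].

Definition dominating (G : sgraph) (D : {set G}) : bool :=
  [forall v, (v \in D) || [exists u in D, adj u v]].

Definition dom_forcing (G : sgraph) (D : {set G}) : bool :=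
  dominating D && zero_forcing D.

Lemma dom_forcingT (G : sgraph) : dom_forcing [set: G].
Proof.
by apply/andP; split; [apply/forallP => v; rewrite inE | apply: connect0].
Qed.

(* The seed [set: G] of the arg min is itself dom-forcing (dom_forcingT), so
   this is a genuine minimum. *)
Definition dom_forcing_number (G : sgraph) : nat :=
  #|[arg min_(D < [set: G] | dom_forcing D) #|D|]|.

(* Vertices of K_{1,n}: the center None and the n leaves Some i. *)
Definition star_adj (n : nat) : rel (option 'I_n) :=
  fun x y => (x == None) (+) (y == None).

Lemma star_adj_sym (n : nat) : symmetric (@star_adj n).
Proof. by move=> x y; rewrite /star_adj addbC. Qed.

Lemma star_adj_irrefl (n : nat) : irreflexive (@star_adj n).
Proof. by move=> x; rewrite /star_adj addbb. Qed.

Definition star (n : nat) : sgraph :=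
  SGraph (@star_adj_sym n) (@star_adj_irrefl n).

(* Main.v *)
Require Import Defs.
From mathcomp Require Import all_boot.

(** A set of two leaves is a fort: the center is adjacent to both, every other
vertex to neither, so if both start white then neither is ever forced. Hence a
zero forcing set omits at most one leaf; if it also omits the center and is
dominating then it omits no leaf. So a dom-forcing set omits at most one
vertex, and omitting a single leaf does give a dom-forcing set. *)

(** Being entirely white is an invariant of [F] under forces, and the all-black colouring violates
    it because [F] is nonempty. *)
Lemma fort_not_zero_forcing (G : sgraph) (F B : {set G}) :
  F != set0 -> [disjoint F & B] ->
  (forall u, u \notin F -> #|[set w in F | adj u w]| != 1) ->
  ~~ zero_forcing B.
Proof.
move=> /set0Pn[x xF] dFB fortF; apply/negP => zB.
pose white := [pred C : {set G} | [disjoint F & C]].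
have step (C C' : {set G}) : force_step C C' -> C \in white -> C' \in white.
  move=> /existsP[u /andP[uC /existsP[v /andP[/eqP wv /eqP ->]]]].
  rewrite !inE => dFC.
  have uF : u \notin F by rewrite (disjointFl dFC).
  rewrite disjoints_subset setCU subsetI -!disjoints_subset dFC andbT.
  rewrite disjoint_sym disjoints1; apply: contra (fortF _ uF) => vF.
  (* As [F] is still white, neighbors of [u] in [F] are white neighbors, so a forced [v] in [F]
     would be the only one. *)
  suff -> : [set w in F | adj u w] = [set v] by rewrite cards1.
  have /setP/(_ v) := wv; rewrite !inE eqxx => /andP[uv _].
  apply/setP => w; rewrite !inE; apply/andP/eqP => [[wF uw]|-> //].
  by apply/set1P; rewrite -wv inE uw (disjointFr dFC).
have dFT : [set: G] \in white.
  have /connectP[p] := zB.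
  have : B \in white by rewrite inE.
  elim: p B {zB dFB} => [|C p IHp] B wB /=; first by move=> _ ->.
  by case/andP=> /step/(_ wB) wC; apply: IHp.
by move: dFT; rewrite inE => /disjointFr/(_ xF); rewrite inE.
Qed.

Lemma card_star (n : nat) : #|star n| = n.+1.
Proof. by rewrite card_option card_ord. Qed.

Lemma two_leaves_not_zero_forcing (n : nat) (i j : 'I_n) (D : {set star n}) :
  i != j -> Some i \notin D -> Some j \notin D -> ~~ zero_forcing D.
Proof.
move=> neq_ij iD jD; pose F : {set star n} := [set Some i; Some j].
apply: (fort_not_zero_forcing _ F).
- by apply/set0Pn; exists (Some i); rewrite !inE eqxx.
- by rewrite disjoints_subset subUset !sub1set !inE iD jD.
case=> [k|] _.
  suff -> : [set w in F | @adj (star n) (Some k) w] = set0 by rewrite cards0.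
  by apply/setP => -[l|]; rewrite !inE ?andbF.
suff -> : [set w in F | @adj (star n) None w] = F.
  by rewrite cards2 (inj_eq Some_inj) neq_ij.
by apply/setP => -[l|]; rewrite !inE ?andbT.
Qed.

Lemma center_leaf_not_dominating (n : nat) (i : 'I_n) (D : {set star n}) :
  None \notin D -> Some i \notin D -> ~~ dominating D.
Proof.
move=> cD iD; apply/forallPn; exists (Some i); rewrite negb_or iD /=.
by apply/existsPn => -[k|]; rewrite ?andbF // (negPf cD).
Qed.

Lemma dom_forcing_star_card (n : nat) (D : {set star n}) :
  dom_forcing D -> n <= #|D|.
Proof.
move=> /andP[domD zfD]; rewrite leqNgt; apply/negP => ltDn.
(* Fewer than [n] of the [n.+1] vertices in [D] leaves two distinct vertices outside: two leaves, or
   the center and a leaf. *)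
have : 1 < #|~: D| by rewrite cardsCs setCK card_star ltn_subRL addn1 ltnS.
case/card_gt1P => x [y]; rewrite !inE => -[].
case: x y => [i|] [j|] // xD yD neq_xy.
- by case/negP: (two_leaves_not_zero_forcing _ _ _ _ neq_xy xD yD).
- by case/negP: (center_leaf_not_dominating _ _ _ yD xD).
- by case/negP: (center_leaf_not_dominating _ _ _ xD yD).
Qed.

Lemma dom_forcing_all_but_leaf (n : nat) (i : 'I_n) :
  @dom_forcing (star n) [set~ Some i].
Proof.
apply/andP; split.
  apply/forallP => -[k|]; rewrite !inE //.
  by apply/orP; right; apply/existsP; exists None; rewrite !inE.
(* One force suffices: the black center has the omitted leaf as its only white neighbor. *)
apply/connect1/existsP; exists None; rewrite !inE /=.
apply/existsP; exists (Some i); rewrite setUCr eqxx andbT.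
by apply/eqP/setP => -[k|]; rewrite !inE ?negbK.
Qed.

Theorem theorem3p11 (n : nat) (hn : 2 <= n) : dom_forcing_number (star n) = n.
Proof.
rewrite /dom_forcing_number.
case: arg_minnP => [|D dfD minD]; first exact: dom_forcingT.
apply/eqP; rewrite eqn_leq dom_forcing_star_card // andbT.
(* [ltnW hn] serves as a proof of [0 < n], so the omitted leaf is the one of index 0. *)
have := minD _ (dom_forcing_all_but_leaf _ (Ordinal (ltnW hn))).
by rewrite cardsC1 card_star.
Qed.
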